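(* Let $\ell>2$. Every $(\ell,0)$-JM partition is a node of the ladder crystal $ladd_\ell$, i.e. can be obtained from the empty partition by applying a finite sequence of ladder crystal operators $\widehat f_i$.
   Context: Partitions are identified with Young diagrams; $(x,y)$ is the box in row $x$, column $y$, with residue $y-x\bmod\ell$. The hook length $h^\lambda_{(a,c)}$ of a box is the number of boxes of $\lambda$ to its right in its row or below it in its column, including itself. $\lambda$ is an $(\ell,0)$-JM partition if there do NOT exist boxes $(a,b),(a,y),(x,b)$ in $\lambda$ with $\ell\mid h^\lambda_{(a,b)}$, $\ell\nmid h^\lambda_{(a,y)}$, $\ell\nmid h^\lambda_{(x,b)}$. Ladder crystal operators: for residue $i$, mark removable boxes of residue $i$ by $-$ and addable positions of residue $i$ by $+$; read them ordering positions $(x,y)$ by ladder number $x+(\ell-1)(y-1)$ increasing and, within a ladder, top to bottom; successively cancel adjacent pairs $-+$. Then $\widehat e_i\lambda$ removes the box of the leftmost remaining $-$ and $\widehat f_i\lambda$ adds the box of the rightmost remaining $+$ (each $0$ if no such sign). The ladder crystal $ladd_\ell$ has as nodes the partitions obtained from the empty partition by finite sequences of the operators $\widehat f_i$, $0\le i<\ell$. *)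

(* Defs.v *)
From mathcomp Require Import all_boot all_order all_algebra.

Set Implicit Arguments.
Unset Strict Implicit.
Unset Printing Implicit Defensive.

(* The parts in weakly decreasing order, without trailing zeros, so that each
   partition has exactly one representation. *)
Definition is_partition (lam : seq nat) : bool :=
  sorted geq lam && (0 \notin lam).

(* A position is a pair (row, column), with rows and columns numbered from 1
   and row 1 on top. *)
Definition position : Type := (nat * nat)%type.

Definition row_length (lam : seq nat) (x : nat) : nat := nth 0 lam x.-1.

Definition boxes (lam : seq nat) : seq position :=
  [seq (x, y) | x <- iota 1 (size lam), y <- iota 1 (row_length lam x)].

Definition residue (l : nat) (p : position) : int :=
  ((p.2%:Z - p.1%:Z)%R %% l%:Z)%Z.

Definition hook_length (lam : seq nat) (p : position) : nat :=
  count (fun q : position => ((q.1 == p.1) && (p.2 <= q.2))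
                          || ((q.2 == p.2) && (p.1 <= q.1)))
        (boxes lam).

Definition JM_partition (l : nat) (lam : seq nat) : Prop :=
  ~ exists a b x y : nat,
      [/\ (a, b) \in boxes lam, (a, y) \in boxes lam & (x, b) \in boxes lam] /\
      [/\ l %| hook_length lam (a, b),
          ~~ (l %| hook_length lam (a, y))
        & ~~ (l %| hook_length lam (x, b))].

Definition removable (lam : seq nat) (p : position) : bool :=
  [&& p \in boxes lam, (p.1.+1, p.2) \notin boxes lam
    & (p.1, p.2.+1) \notin boxes lam].

Definition addable (lam : seq nat) (p : position) : bool :=
  [&& 0 < p.1, 0 < p.2, p \notin boxes lam,
      (p.1 == 1) || ((p.1.-1, p.2) \in boxes lam)
    & (p.2 == 1) || ((p.1, p.2.-1) \in boxes lam)].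

Definition add_box (lam : seq nat) (p : position) : seq nat :=
  incr_nth lam p.1.-1.

Definition ladder (l : nat) (p : position) : nat := p.1 + l.-1 * p.2.-1.

Definition reading_order (l : nat) : rel position :=
  fun p q => (ladder l p < ladder l q)
          || ((ladder l p == ladder l q) && (p.1 <= q.1)).

(* Every addable or removable position lies in this rectangle. *)
Definition rectangle (lam : seq nat) : seq position :=
  [seq (x, y) | x <- iota 1 (size lam).+1, y <- iota 1 (head 0 lam).+1].

(* Positions are signed by a boolean: true stands for + (addable) and
   false for - (removable). *)
Definition signature (l i : nat) (lam : seq nat) : seq (bool * position) :=
  [seq (addable lam p, p)
     | p <- sort (reading_order l)
              [seq p <- rectangle lam
                 | (residue l p == Posz i) && (addable lam p || removable lam p)]].

(* Cancellation of adjacent pairs -+ until none is left. The final word does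
   not depend on the order of the cancellations; here the tail is reduced
   first, and its leading + (if any) cancels with a - in front of it. *)
Fixpoint cancel_signs (s : seq (bool * position)) : seq (bool * position) :=
  if s is c :: s' then
    match c, cancel_signs s' with
    | (false, _), (true, _) :: r => r
    | _, r => c :: r
    end
  else [::].

(* None stands for the value 0 of the operator. *)
Definition f_hat (l i : nat) (lam : seq nat) : option (seq nat) :=
  omap (fun c => add_box lam c.2)
       (ohead (rev [seq c <- cancel_signs (signature l i lam) | c.1])).

Inductive ladder_node (l : nat) : seq nat -> Prop :=
| ladder_node_empty : ladder_node l [::]
| ladder_node_f (i : nat) (lam mu : seq nat) :
    i < l -> ladder_node l lam -> f_hat l i lam = Some mu -> ladder_node l mu.

(* Main.v *)
(** Encode a partition by its bead set {lam_x - x}: boxes are pairs gap < bead,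
    hook lengths are differences, and the JM condition says that a box (a, b)
    with l | b - a has either all gaps before b or all beads after a on its own
    runner modulo l. Let lam be a nonempty JM partition and i the residue of one
    of its removable boxes. In the ladder reading order every addable position of
    residue i precedes every removable box of residue i, so no cancellation ever
    happens and f_i successively adds back the removable boxes of residue i
    starting from the partition nu where all of them have been removed. Moreover
    nu is again a JM partition: if lam has no addable position of residue i, then
    nu arises by exchanging two adjacent runners; otherwise lam has exactly one,
    and the JM condition at this position determines the runners on one side of
    it almost completely. Induction on the number of boxes concludes. *)

Require Import Defs.
From mathcomp Require Import all_boot all_order all_algebra.
From mathcomp Require Import zify.

Set Implicit Arguments.
Unset Strict Implicit.
Unset Printing Implicit Defensive.

Import Order.TTheory GRing.Theory Num.Theory.

(** * Bead sets modulo [l] and the removal of one residue *)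

Section BeadSets.

Local Open Scope ring_scope.

Variable l : nat.
Hypothesis l_gt1 : (1 < l)%N.

Definition cong (a b : int) : bool := (l%:Z %| a - b)%Z.

Lemma congxx a : cong a a.
Proof. by rewrite /cong subrr dvdz0. Qed.

Lemma cong_sym a b : cong a b = cong b a.
Proof. by rewrite /cong -opprB rpredN. Qed.

Lemma cong_trans b a c : cong a b -> cong b c -> cong a c.
Proof. by rewrite /cong => ab bc; rewrite -(subrKA b) rpredD. Qed.

Lemma cong_add c a b : cong (a + c) (b + c) = cong a b.
Proof. by rewrite /cong opprD addrACA subrr addr0. Qed.

Lemma cong_opp a b : cong (- a) (- b) = cong a b.
Proof. by rewrite /cong -opprD rpredN. Qed.

Lemma cong_pred a : cong (a - 1) a = false.
Proof.
rewrite /cong addrAC subrr sub0r rpredN dvdzE /= dvdn1.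
by apply/negbTE; case: eqP l_gt1 => // ->.
Qed.

(* A gap [a] and a bead [b] with [a < b] encode a box of hook length [b - a];
   a gap [a'] and a bead [b'] then point to boxes in the same row and column. *)
Definition JM_beads (B : int -> bool) : Prop :=
  forall a b a' b', ~~ B a -> B b -> ~~ B a' -> B b' ->
    a < b -> a' < b -> a < b' -> cong a b -> cong a' b || cong a b'.

(* A gap at [z - 1] and a bead at [z] form a removable box of content [z], and
   the converse configuration is an addable position of content [z]. Thus
   [flushed i B B'] says that removing every removable box of residue [i]
   turns [B] into [B']. *)
Definition flushed (i : int) (B B' : int -> bool) : Prop :=
  forall z,
    [/\ cong z i -> B' (z - 1) = B (z - 1) || B z /\ B' z = B (z - 1) && B z
      & ~~ cong z i -> ~~ cong (z + 1) i -> B' z = B z].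

Definition swap_runners (i z : int) : int :=
  if cong z i then z - 1 else if cong (z + 1) i then z + 1 else z.

Lemma cong_succl i z : cong z i -> cong (z + 1) i = false.
Proof.
move=> zi; apply/negP => zi'; have := cong_pred (z + 1).
by rewrite addrK (cong_trans zi) // cong_sym.
Qed.

Lemma cong_swap i a b : cong a b ->
  cong (swap_runners i a) (swap_runners i b).
Proof.
have ct c d : cong c d -> cong c i = cong d i.
  move=> cd; apply/idP/idP; last exact: cong_trans.
  by apply: cong_trans; rewrite cong_sym.
move=> ab; have ab1 : cong (a + 1) (b + 1) by rewrite cong_add.
rewrite /swap_runners (ct _ _ ab) (ct _ _ ab1).
by do 2?[case: ifP => _; first by rewrite cong_add].
Qed.

Lemma swap_runnersK i : involutive (swap_runners i).
Proof.
move=> z; rewrite {2}/swap_runners; case: ifP => [zi|zi].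
  rewrite /swap_runners subrK zi ifF //; apply/negP => zi1.
  by have := cong_succl zi1; rewrite subrK zi.
case: ifP => zi1; first by rewrite /swap_runners zi1 addrK.
by rewrite /swap_runners zi zi1.
Qed.

Lemma cong_swapE i a b :
  cong (swap_runners i a) (swap_runners i b) = cong a b.
Proof.
apply/idP/idP; last exact: cong_swap.
by move/(cong_swap i); rewrite !swap_runnersK.
Qed.

(** Each point moves by at most one, so only [b - a] equal to 1 or 2 is critical. At distance 2 the
    points cannot move towards each other, since [a + 1] and [b] would both lie on runner [i]; at
    distance 1 they trade places only in the excluded configuration. *)
Lemma swap_lt i a b : a < b -> ~~ (cong b i && (b == a + 1)) ->
  swap_runners i a < swap_runners i b.
Proof.
move=> ab; rewrite negb_and -implybE /swap_runners => nab.
have [e|ne] := eqVneq b (a + 1).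
  subst b; rewrite eqxx implybF in nab; rewrite (negPf nab).
  by repeat case: ifP => _; lia.
case: (boolP (b == a + 1 + 1)) => [/eqP e|ne2]; last first.
  by repeat case: ifP => _; lia.
subst b; case: ifP => _; first by repeat case: ifP => _; lia.
have nn : cong (a + 1 + 1) i -> cong (a + 1) i = false.
  by move=> c; apply/negP => /cong_succl; rewrite c.
by case: (boolP (cong (a + 1 + 1) i)) => [/nn ->|_]; repeat case: ifP => _; lia.
Qed.

Lemma flushed_slot i B B' z :
  flushed i B B' -> cong z i -> B' z -> B' (z - 1).
Proof. by move=> fl ci; have [/(_ ci) [-> ->] _] := fl z; case/andP=> ->. Qed.

Lemma flushed_top i B B' z :
  flushed i B B' -> cong z i -> B' z = B (z - 1) && B z.
Proof. by move=> fl ci; have [/(_ ci) [_ ->] _] := fl z. Qed.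

Lemma flushed_bot i B B' z :
  flushed i B B' -> cong (z + 1) i -> B' z = B z || B (z + 1).
Proof. by move=> fl ci; have [/(_ ci) [] + _ _] := fl (z + 1); rewrite addrK. Qed.

Lemma flushed_out i B B' z :
  flushed i B B' -> ~~ cong z i -> ~~ cong (z + 1) i -> B' z = B z.
Proof. by move=> fl; have [_] := fl z. Qed.

(* When no box of residue [i] is addable, flushing exchanges two runners. *)
Lemma JM_flushed_no_addable i B B' :
  flushed i B B' -> JM_beads B ->
  (forall z, cong z i -> B (z - 1) -> B z) -> JM_beads B'.
Proof.
move=> fl JM noadd.
have swapE z : B' z = B (swap_runners i z).
  rewrite /swap_runners; case: ifP => zi.
    by rewrite (flushed_top fl zi); apply/andb_idr/noadd.
  case: ifP => zi1; last by apply: (flushed_out fl); rewrite ?zi ?zi1.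
  rewrite (flushed_bot fl zi1); apply/orb_idl => Bz.
  by apply: noadd; rewrite ?addrK.
(* A reversed pair would be a gap [b - 1] and a bead [b] on runner [i], and flushing leaves none. *)
have lt a b : ~~ B' a -> B' b -> a < b -> swap_runners i a < swap_runners i b.
  move=> Ba Bb ab; apply: swap_lt => //; apply/andP => -[bi /eqP e].
  by have := flushed_slot fl bi Bb; rewrite e addrK (negPf Ba).
move=> a b a' b' Ba Bb Ba' Bb' ab a'b ab' cab.
rewrite -(cong_swapE i a') -(cong_swapE i a).
by apply: JM; rewrite -?swapE ?cong_swapE ?lt.
Qed.

(** The box of gap [q - 1] and bead [p - 1] has hook length divisible by [l], while the bead [q] is
    off the runner of [q - 1]. The JM condition thus puts all gaps of [B] before [p - 1] on the
    runner of [p - 1], and it keeps all later beads off that runner. After flushing, gaps before [p]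
    lie on runner [i] and beads from [p] on avoid it. *)
Lemma JM_flushed_removable_lt i B B' p q :
  flushed i B B' -> JM_beads B ->
  cong p i -> B (p - 1) -> ~~ B p ->
  cong q i -> ~~ B (q - 1) -> B q ->
  q < p -> JM_beads B'.
Proof.
move=> fl JM pi Bp1 Bp qi Bq1 Bq qp.
have cqp : cong q p by rewrite (cong_trans qi) // cong_sym.
have gap_low g : ~~ B g -> g < p - 1 -> cong (g + 1) i.
  move=> Bg gp; have := JM (q - 1) (p - 1) g q Bq1 Bp1 Bg Bq.
  rewrite cong_pred orbF cong_add => /(_ _ _ _ cqp) h.
  apply: cong_trans pi; rewrite -(subrK 1 p) cong_add; apply: h; clear -qp gp; lia.
have gt_p b : B b -> p - 1 < b -> p < b.
  move=> Bb pb; have: p != b by apply: contraNneq Bp => ->.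
  by clear -pb; lia.
have bead_high b : B b -> p - 1 < b -> ~~ cong (b + 1) i.
  move=> Bb pb; apply/negP => bi.
  have cb : cong (q - 1) b.
    by rewrite -(cong_add 1) subrK (cong_trans qi) // cong_sym.
  have pb' := gt_p _ Bb pb.
  have := JM (q - 1) b p q Bq1 Bb Bp Bq.
  rewrite cong_pred orbF => /(_ _ pb' _ cb) h.
  have: cong (p - 1) p.
    apply: (@cong_trans b); last by rewrite cong_sym; apply: h; clear -qp pb; lia.
    by rewrite -(cong_add 1) subrK (cong_trans pi) // cong_sym.
  by rewrite cong_pred.
have gap_low' g : ~~ B' g -> g < p -> cong g i.
  move=> Bg gp; apply/negPn/negP => gi.
  have gp1 : g != p - 1.
    apply: contraNneq Bg => ->.
    by rewrite (flushed_bot fl) subrK // Bp1.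
  have gp2 : g < p - 1 by clear -gp gp1; lia.
  have [gi1|gi1] := boolP (cong (g + 1) i).
    move: Bg; rewrite (flushed_bot fl gi1) negb_or => /andP[_ Bg1].
    have gp3 : g + 1 < p - 1.
      have: g + 1 != p - 1 by apply: contraNneq Bg1 => ->.
      by clear -gp2; lia.
    by have := cong_succl gi1; rewrite gap_low.
  by move: Bg; rewrite (flushed_out fl) // => /gap_low /(_ gp2); rewrite (negPf gi1).
have bead_high' b : B' b -> p - 1 < b -> ~~ cong b i.
  move=> Bb pb; apply/negP => bi; move: Bb; rewrite (flushed_top fl bi).
  case/andP => Bb1 Bb; have pb' := gt_p _ Bb pb.
  have: ~~ cong (b - 1 + 1) i by apply: bead_high Bb1 _; clear -pb'; lia.
  by rewrite subrK bi.
(* Beyond [p - 1] no bead of [B] is on runner [i - 1], so a bead of [B'] there comes from runner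
   [i]. *)
have bead_swap b : B' b -> p - 1 < b -> B (swap_runners i b).
  move=> Bb pb; have bi := bead_high' _ Bb pb; rewrite /swap_runners (negPf bi).
  case: ifP => bi1; last by rewrite -(flushed_out fl) ?bi1.
  move: Bb; rewrite (flushed_bot fl bi1) => /orP[Bb|//].
  by have := bead_high _ Bb pb; rewrite bi1.
have gap_swap g : ~~ B' g -> ~~ cong g i -> ~~ B (swap_runners i g).
  move=> Bg gi; rewrite /swap_runners (negPf gi).
  case: ifP => gi1; last by rewrite -(flushed_out fl) ?gi1.
  by move: Bg; rewrite (flushed_bot fl gi1) negb_or => /andP[].
move=> a b a' b' Ba Bb Ba' Bb' ab a'b ab' cab.
(* Before [p] both gaps [a] and [a'] are on runner [i], hence so is [b]. Otherwise [b], and with it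
   [a], is off runner [i], which forces [p <= a]. *)
have [bp|pb] := ltP b p.
  apply/orP; left; apply: (cong_trans (gap_low' _ Ba' (lt_trans a'b bp))).
  rewrite cong_sym in cab; rewrite cong_sym.
  exact: cong_trans cab (gap_low' _ Ba (lt_trans ab bp)).
have pb1 : p - 1 < b by clear -pb; lia.
have bi := bead_high' _ Bb pb1.
have ai : ~~ cong a i.
  by apply: contra bi; apply: cong_trans; rewrite cong_sym.
have ap : p <= a by rewrite leNgt; apply: contra ai; exact: gap_low'.
have pb1' : p - 1 < b' by clear -ap ab'; lia.
have bi' := bead_high' _ Bb' pb1'.
rewrite -(cong_swapE i a b').
have sab : swap_runners i a < swap_runners i b by apply: swap_lt; rewrite ?(negPf bi).
have sab' : swap_runners i a < swap_runners i b' by apply: swap_lt; rewrite ?(negPf bi').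
have sb : q - 1 < swap_runners i b.
  by rewrite /swap_runners (negPf bi); clear -qp pb; case: ifP => _; lia.
(* The gap [q - 1] stands in for [a']: it could be congruent to [swap_runners i b] only with [b] on
   runner [i], so the alternative about [b'] must hold. *)
have := JM _ _ _ _ (gap_swap _ Ba ai) (bead_swap _ Bb pb1) Bq1 (bead_swap _ Bb' pb1') sab sb sab'.
rewrite cong_swapE => /(_ cab) /orP[cq|->]; last by rewrite orbT.
case/negP: bi; rewrite -(swap_runnersK i b).
set c := swap_runners i b in cq *.
have ci : cong (c + 1) i.
  by apply: cong_trans qi; rewrite -(subrK 1 q) cong_add cong_sym.
rewrite /swap_runners ci ifF //; apply/negP => /cong_succl.
by rewrite ci.
Qed.

(* Conjugation of partitions. *)
Definition dual (B : int -> bool) (z : int) : bool := ~~ B (- z).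

Lemma JM_dual B : JM_beads B -> JM_beads (dual B).
Proof.
rewrite /dual => JM a b a' b'; rewrite !negbK => Ba Bb Ba' Bb' ab a'b ab' cab.
have := JM _ _ _ _ Bb Ba Bb' Ba'; rewrite !cong_opp !ltrN2 cong_sym.
by move=> /(_ ab ab' a'b cab); rewrite (cong_sym b') (cong_sym b) orbC.
Qed.

Lemma dualK B : dual (dual B) =1 B.
Proof. by move=> z; rewrite /dual opprK negbK. Qed.

Lemma eq_JM B B' : B =1 B' -> JM_beads B -> JM_beads B'.
Proof. by move=> e JM a b a' b'; rewrite -!e; exact: JM. Qed.

(** Reflection sends the pair [z - 1], [z] to [- z], [1 - z], whence [1 - i] instead of [- i]. *)
Lemma flushed_dual i B B' :
  flushed i B B' -> flushed (1 - i) (dual B) (dual B').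
Proof.
move=> fl z; rewrite /dual.
have e : cong z (1 - i) = cong (- z + 1) i.
  by rewrite -cong_opp opprB -(cong_add 1) subrK.
have e1 : cong (z + 1) (1 - i) = cong (- z) i.
  by rewrite (addrC 1) cong_add -cong_opp opprK.
rewrite e e1; split => [zi|zi1 zi].
  rewrite opprB addrC (flushed_top fl zi) (flushed_bot fl zi) addrK.
  by rewrite negb_or negb_and orbC andbC.
by rewrite (flushed_out fl).
Qed.

(** If residue [i] has both an addable position and a removable box, the previous lemma applies to
    [B] or to its dual. With no removable box nothing changes, and with no addable position two
    runners are exchanged. *)
Lemma JM_flushed i B B' : flushed i B B' -> JM_beads B -> JM_beads B'.
Proof.
move=> fl JM a b a' b' Ba Bb Ba' Bb' ab a'b ab' cab.
(* The existence of an addable position is undecidable for an arbitrary [B]; the boolean goal allows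
   arguing by contradiction. *)
apply: contraT => /negP nG.
have nJM : ~ JM_beads B'.
  by move=> JM'; apply/nG/(JM' a b a' b').
have excl p q : cong p i -> B (p - 1) -> ~~ B p ->
    cong q i -> ~~ B (q - 1) -> ~~ B q.
  move=> pi Bp1 Bp qi Bq1; apply/negP => Bq.
  case: (ltgtP q p) => [qp|pq|e]; last by rewrite e (negPf Bp) in Bq.
    exact/nJM/(JM_flushed_removable_lt fl JM pi Bp1 Bp qi Bq1 Bq qp).
  (* Conjugation reverses the order: [1 - q < 1 - p] replace [q] and [p]. *)
  have ci z : cong z i -> cong (1 - z) (1 - i).
    by rewrite !(addrC 1) cong_add cong_opp.
  have e z : - (1 - z - 1) = z by rewrite addrAC subrr sub0r opprK.
  apply/nJM/(eq_JM (dualK B'))/JM_dual.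
  apply: (JM_flushed_removable_lt (flushed_dual fl) (JM_dual JM) (ci _ pi) _ _
            (ci _ qi)); rewrite /dual ?e ?opprB ?negbK //.
  by clear -pq; lia.
have noadd z : cong z i -> B (z - 1) -> B z.
  move=> zi Bz1; apply/negPn/negP => Bz; apply/nJM/(@eq_JM B) => // w.
  have norem v : cong v i -> B v -> B (v - 1).
    by move=> vi; apply: contraTT; exact: (excl z v zi Bz1 Bz vi).
  have [wi|wi] := boolP (cong w i).
    rewrite (flushed_top fl wi) andb_idl //; exact: norem.
  have [wi1|wi1] := boolP (cong (w + 1) i).
    rewrite (flushed_bot fl wi1) orb_idr // => /(norem _ wi1).
    by rewrite addrK.
  by rewrite (flushed_out fl).
by case: (nJM (JM_flushed_no_addable fl JM noadd)).
Qed.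

End BeadSets.

(** * Rows, columns and hook lengths *)

Definition col_length (lam : seq nat) (y : nat) : nat :=
  count (fun r => y <= r) lam.

Lemma mem_boxes lam x y :
  ((x, y) \in boxes lam) = [&& 0 < x, 0 < y & y <= row_length lam x].
Proof.
apply/allpairsPdep/and3P => /= [[x' [y' [hx hy [-> ->]]]]|[x0 y0 yx]].
  by move: hx hy; rewrite !mem_iota => hx hy; split; lia.
exists x, y; split => //; rewrite !mem_iota; last by lia.
rewrite x0 /= add1n ltnS leqNgt; apply/negP => lx.
by move: yx; rewrite /row_length nth_default; lia.
Qed.

Lemma partitionP lam :
  reflect ((forall k, nth 0 lam k.+1 <= nth 0 lam k) /\
           (forall k, k < size lam -> 0 < nth 0 lam k))
          (is_partition lam).
Proof.
apply: (iffP andP) => [[/(sortedP 0) so n0]|[dec pos]]; split.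
- move=> k; case: (ltnP k.+1 (size lam)) => [/so //|?].
  by rewrite nth_default.
- move=> k hk; rewrite lt0n; apply: contra n0 => /eqP <-.
  exact: mem_nth.
- by apply/(sortedP 0) => k _; exact: dec.
by apply/negP => /(nthP 0) [k /pos hk e]; rewrite e in hk.
Qed.

Lemma row_length_le lam x x' :
  is_partition lam -> x <= x' -> row_length lam x' <= row_length lam x.
Proof.
case/partitionP => dec _ xx'; rewrite /row_length.
have: x.-1 <= x'.-1 by lia.
elim: x'.-1 => [|k IH]; first by rewrite leqn0 => /eqP ->.
rewrite leq_eqVlt => /orP[/eqP -> //|/IH]; exact: leq_trans.
Qed.

Lemma leq_col_length lam x y :
  is_partition lam -> 0 < x -> 0 < y ->
  (x <= col_length lam y) = (y <= row_length lam x).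
Proof.
case: x => // x /andP[so _] _ y0; rewrite /row_length /=.
elim: lam x so => [|r lam IH] x so; first by rewrite /col_length nth_nil /=; lia.
have /= pa := so; rewrite (path_sortedE (fun _ _ _ h1 h2 => leq_trans h2 h1)) in pa.
case/andP: pa => /allP al so'.
rewrite /col_length /=; case: (leqP y r) => yr.
  by case: x => [|x]; [rewrite yr|rewrite add1n ltnS IH].
have -> : count (fun r0 => y <= r0) lam = 0.
  by apply/eqP; rewrite -leqn0 leqNgt -has_count; apply/hasPn => z /al /= zr; rewrite -ltnNge; lia.
case: x => [|x] /=; first by lia.
by case: (ltnP x (size lam)) => hx; [have := al _ (mem_nth 0 hx) => /= | rewrite nth_default //]; lia.
Qed.

(** The corner is counted in [arm] and left out of [leg], which makes the two lists disjoint. *)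
Lemma hook_lengthE lam a b :
  is_partition lam -> (a, b) \in boxes lam ->
  hook_length lam (a, b) = (row_length lam a - b) + (col_length lam b - a) + 1.
Proof.
move=> hp; rewrite mem_boxes => /and3P[a0 b0 ba].
rewrite /hook_length; set P := (P in count P _); rewrite -size_filter.
pose arm := [seq (a, y) | y <- iota b (row_length lam a - b).+1].
pose leg := [seq (x, b) | x <- iota a.+1 (col_length lam b - a)].
have ub : uniq (boxes lam).
  by apply: allpairs_uniq_dep => [|x _|[x y] [x' y'] _ _ /= [-> ->]]; rewrite ?iota_uniq.
have ua : uniq (arm ++ leg).
  rewrite cat_uniq !map_inj_uniq ?iota_uniq ?andbT /=; try by move=> ? ? [].
  apply/hasPn => _ /mapP[x hx ->]; apply/negP => /mapP[y _ [e _]].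
  by move: hx; rewrite mem_iota e; lia.
have acb : (a <= col_length lam b) by rewrite leq_col_length.
suff /(uniq_perm (filter_uniq P ub) ua)/perm_size -> : [seq q <- boxes lam | P q] =i arm ++ leg.
  by rewrite size_cat !size_map !size_iota; lia.
case=> x y; rewrite mem_filter mem_boxes mem_cat /P /=.
apply/andP/orP => [[/orP[]]|[]].
- case/andP => /eqP -> by_ /and3P[_ _ yr]; left; apply/mapP; exists y => //.
  by rewrite mem_iota; lia.
- case/andP => /eqP -> ax /and3P[x0 _ yr].
  case: (ltnP a x) => ax'; last first.
    left; apply/mapP; exists b; first by rewrite mem_iota; lia.
    by congr (_, _); lia.
  right; apply/mapP; exists x => //; rewrite mem_iota.
  by move: yr; rewrite -leq_col_length //; lia.
- by case/mapP => y' hy [-> ->]; move: hy; rewrite mem_iota => hy; split; lia.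
case/mapP => x' hx [-> ->]; move: hx; rewrite mem_iota => hx; split; first by lia.
by rewrite b0 -leq_col_length //; lia.
Qed.


(** * The bead set of a partition *)

Section Partitions.

Variable lam : seq nat.

Lemma boxE x y : 0 < x -> 0 < y ->
  ((x, y) \in boxes lam) = (y <= row_length lam x).
Proof. by move=> x0 y0; rewrite mem_boxes x0 y0. Qed.

(* The rows are beads and the columns are gaps: the integers [row_bead x] and
   [col_gap y] partition [int], and [hook_length lam (x, y)] is
   [row_bead x - col_gap y]. *)
Definition row_bead (x : nat) : int := ((row_length lam x)%:Z - x%:Z)%R.

Definition col_gap (y : nat) : int := (y%:Z - 1 - (col_length lam y)%:Z)%R.

(** Beyond [size lam] the bead of row [x] is [- x], so this finite range of rows suffices to decide
    membership. *)
Definition bead (z : int) : bool :=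
  z \in [seq row_bead x | x <- iota 1 (size lam + `|z|)].

Lemma beadP z : reflect (exists2 x, 0 < x & row_bead x = z) (bead z).
Proof.
apply: (iffP mapP) => [[x hx ->]|[x x0 <-]]; exists x => //.
  by move: hx; rewrite mem_iota => /andP[].
rewrite mem_iota x0 add1n ltnS /=; case: (leqP x (size lam)) => [|hx].
  by move/leq_trans; apply; exact: leq_addr.
by rewrite /row_bead /row_length nth_default; lia.
Qed.

Hypothesis lam_part : is_partition lam.

Lemma row_bead_lt x x' : x < x' -> (row_bead x' < row_bead x)%R.
Proof. by move=> h; have := row_length_le lam_part (ltnW h); rewrite /row_bead; lia. Qed.

Lemma row_bead_inj x x' : row_bead x = row_bead x' -> x = x'.
Proof.
by move=> e; case: (ltngtP x x') => // /row_bead_lt; rewrite e ltxx.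
Qed.

Lemma mem_boxesE x y : 0 < x -> 0 < y ->
  ((x, y) \in boxes lam) = (col_gap y < row_bead x)%R.
Proof.
move=> x0 y0; rewrite boxE // -leq_col_length //.
have := leq_col_length lam_part x0 y0.
by rewrite /col_gap /row_bead; lia.
Qed.

(** If [x] is the first row whose bead is below the non-bead [z], then column [z + x] has length
    [x - 1], and its gap is [z]. *)
Lemma gapP z : reflect (exists2 y, 0 < y & col_gap y = z) (~~ bead z).
Proof.
apply: (iffP idP) => [nb|[y y0 <-]]; last first.
  apply/negP => /beadP[x x0]; have := leq_col_length lam_part x0 y0.
  by rewrite /col_gap /row_bead; lia.
pose P x := (0 < x) && (row_bead x <= z)%R.
have exP : exists x, P x.
  exists (size lam + `|z|).+1; rewrite /P /row_bead /row_length nth_default; lia.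
case: (ex_minnP exP) => x /andP[x0 xz] xmin.
have {}xz : (row_bead x < z)%R.
  by rewrite lt_neqAle xz andbT; apply: contra nb => /eqP <-; apply/beadP; exists x.
pose y := `|(z + x%:Z)%R|%N.
have y0 : 0 < y by move: xz; rewrite /y /row_bead; lia.
exists y => //.
suff e : col_length lam y = x.-1 by move: xz; rewrite /col_gap e /y /row_bead; lia.
apply/eqP; rewrite eqn_leq; apply/andP; split.
  rewrite -ltnS prednK // ltnNge leq_col_length // -ltnNge.
  by move: xz; rewrite /y /row_bead; lia.
case: (posnP x.-1) => [->//|x1]; rewrite leq_col_length //.
case: (leqP y (row_length lam x.-1)) => // hy.
have: x <= x.-1 by apply: xmin; rewrite /P x1; move: hy xz; rewrite /y /row_bead; lia.
by lia.
Qed.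

Lemma cong_hook l x y : (x, y) \in boxes lam ->
  cong l (col_gap y) (row_bead x) = (l %| hook_length lam (x, y)).
Proof.
move=> b; rewrite hook_lengthE //; move: b; rewrite mem_boxes => /and3P[x0 y0 yx].
have := leq_col_length lam_part x0 y0; rewrite yx => xy.
by rewrite cong_sym /cong dvdzE; congr (_ %| _); rewrite /row_bead /col_gap; lia.
Qed.

Lemma JM_partitionP l : JM_partition l lam <-> JM_beads l bead.
Proof.
split=> [JM a b a' b'|JM [a [b [x [y [[hab hay hxb]]]]]]].
  case/gapP => y y0 <- /beadP[x x0 <-] /gapP[y' y'0 <-] /beadP[x' x'0 <-].
  rewrite -!mem_boxesE // => h1 h2 h3; rewrite !cong_hook // => d1.
  apply: contraT; rewrite negb_or => /andP[d2 d3]; case: JM.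
  by exists x, y, x', y'.
rewrite -!cong_hook // => -[d1 d2 d3].
move: (hab) (hay) (hxb); rewrite !mem_boxes => /and3P[a0 b0 _] /and3P[_ y0 _] /and3P[x0 _ _].
rewrite !mem_boxesE // in hab hay hxb.
have nb z : 0 < z -> ~~ bead (col_gap z) by move=> z0; apply/gapP; exists z.
have bb z : 0 < z -> bead (row_bead z) by move=> z0; apply/beadP; exists z.
have := JM _ _ _ _ (nb _ b0) (bb _ a0) (nb _ y0) (bb _ x0) hab hay hxb d1.
by rewrite (negPf d2) (negPf d3).
Qed.

Lemma addable_row x y : addable lam (x, y) ->
  [/\ 0 < x, 0 < y, row_length lam x = y.-1 & col_length lam y = x.-1].
Proof.
case/and5P => /= x0 y0; rewrite boxE // -ltnNge => nb up left; split=> //.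
  apply/eqP; rewrite eqn_leq -ltnS prednK // nb /=.
  by case/orP: left => [/eqP ->//|]; rewrite mem_boxes => /and3P[].
apply/eqP; rewrite eqn_leq -ltnS prednK // ltnNge leq_col_length // -ltnNge nb.
case/orP: up => [/eqP -> //|]; rewrite mem_boxes => /and3P[x1 _ h].
by rewrite /= leq_col_length.
Qed.

Lemma removable_row x y : removable lam (x, y) ->
  [/\ 0 < x, 0 < y, row_length lam x = y & col_length lam y = x].
Proof.
case/and3P => /=; rewrite mem_boxes => /and3P[x0 y0 yx]; rewrite !boxE // => d r.
split=> //; apply/eqP; rewrite eqn_leq; first by rewrite yx leqNgt r.
by rewrite leq_col_length // yx leqNgt leq_col_length // d.
Qed.

Lemma removableE x y : 0 < x -> 0 < y ->
  row_length lam x = y -> col_length lam y = x -> removable lam (x, y).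
Proof.
move=> x0 y0 r c; rewrite /removable /= !boxE // r leqnn ltnn andbT /=.
by rewrite -leq_col_length // c ltnn.
Qed.

End Partitions.

(** * Ladder comparison of addable and removable positions *)

Lemma residue_eq l x y u v : residue l (x, y) = residue l (u, v) ->
  cong l (y%:Z - x%:Z)%R (v%:Z - u%:Z)%R.
Proof. by move/eqP; rewrite /residue eqz_mod_dvd. Qed.

(** Distinct multiples of [l] differ by at least [l], and the last value, being positive, is itself
    at least [l]. *)
Lemma dvdn_decreasing l m (f : nat -> nat) b :
  (forall c, b <= c <= m -> (l %| f c) && (0 < f c)) ->
  (forall c, b <= c < m -> f c.+1 < f c) ->
  b <= m -> l * (m - b).+1 <= f b.
Proof.
move=> dv dec bm; have [k e] : {k | m - b = k} by exists (m - b).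
rewrite e; elim: k b e bm dv dec => [|k IH] b e bm dv dec.
  rewrite muln1; have /dv/andP[d p] : b <= b <= m by lia.
  exact: dvdn_leq.
have := IH b.+1; rewrite -ltnS => /(_ _ _ _ _) h.
have {}h : l * k.+1 <= f b.+1.
  by apply: h; [lia|lia|move=> c hc; apply: dv; lia|move=> c hc; apply: dec; lia].
have /dv/andP[d p] : b <= b <= m by lia.
have /dv/andP[d' p'] : b <= b.+1 <= m by lia.
have lt : f b.+1 < f b by apply: dec; lia.
have: l <= f b - f b.+1 by apply: dvdn_leq; [lia|exact: dvdn_sub].
by rewrite mulnSr; lia.
Qed.

(* If [p] and [q] have equal residue, the box in the row of the upper one and
   the column of the lower one has a hook length divisible by [l]; as [q] has
   hook length 1, the JM condition forces the whole row or column through [p]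
   to be divisible, and the hook lengths along it drop by at least [l] at each
   step. This bounds the horizontal distance by the vertical one (or
   conversely) strongly enough to compare ladders. *)
Lemma addable_before_removable l lam p q :
  2 < l -> is_partition lam -> JM_partition l lam ->
  addable lam p -> removable lam q -> residue l p = residue l q ->
  reading_order l p q.
Proof.
case: p q => [x y] [u v] hl hp JM /(addable_row hp)[x0 y0 rx cy].
case/(removable_row hp) => u0 v0 ru cv /residue_eq re.
have uv : (u, v) \in boxes lam by rewrite boxE // ru.
have h1 : ~~ (l %| hook_length lam (u, v)).
  by rewrite hook_lengthE // ru cv !subnn dvdn1; apply/eqP; lia.
have ct : cong l (col_gap lam v) (row_bead lam x) = cong l (y%:Z - x%:Z)%R (v%:Z - u%:Z)%R.
  rewrite cong_sym -(cong_add _ 1); congr cong; rewrite /col_gap /row_bead ?rx ?cv; lia.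
have ct' : cong l (col_gap lam y) (row_bead lam u) = cong l (y%:Z - x%:Z)%R (v%:Z - u%:Z)%R.
  congr cong; rewrite /col_gap /row_bead ?ru ?cy; lia.
case: (leqP x u) => xu.
  have vy : v < y by have := row_length_le hp xu; rewrite ru rx; lia.
  have xv : (x, v) \in boxes lam by rewrite boxE // rx; lia.
  have d : l %| hook_length lam (x, v) by rewrite -cong_hook // ct.
  have row c : 0 < c -> c < y -> l %| hook_length lam (x, c).
    move=> c0 cy'; apply: contraT => nd; case: JM; exists x, v, u, c.
    by split; split=> //; rewrite boxE // rx; lia.
  have H c : 0 < c < y -> hook_length lam (x, c) = (y.-1 - c) + (col_length lam c - x) + 1.
    by move=> hc; rewrite hook_lengthE ?boxE ?rx //; lia.
  have cl c : 0 < c -> col_length lam c.+1 <= col_length lam c.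
    move=> c0; case: (posnP (col_length lam c.+1)) => [->//|h].
    by rewrite leq_col_length // ltnW // -leq_col_length.
  have: l * (y.-1 - v).+1 <= hook_length lam (x, v).
    apply: (@dvdn_decreasing l y.-1 (fun c => hook_length lam (x, c)) v).
    - by move=> c hc; rewrite row ?H; lia.
    - by move=> c hc; rewrite !H; [have := cl c|..]; lia.
    - by lia.
  rewrite H; last by lia.
  rewrite cv /reading_order /ladder /=; case: l hl {JM h1 ct ct' re d row} => // l _ h.
  (* The bound amounts to [(l - 1) * (y - v) <= u - x], which compares the ladders; a tie is settled
     by [x <= u]. *)
  rewrite xu andbT orbC -leq_eqVlt.
  have -> : y.-1 = v.-1 + (y.-1 - v).+1 by lia.
  rewrite mulnDr; move: h; rewrite mulSn; set t := l.+1.-1 * _; rewrite -/(l * _) /=.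
  by lia.
have yv : y <= v by rewrite -ru -leq_col_length // cy; lia.
have uy : (u, y) \in boxes lam by rewrite boxE // ru.
have d : l %| hook_length lam (u, y) by rewrite -cong_hook // ct'.
have col c : 0 < c -> c < x -> l %| hook_length lam (c, y).
  move=> c0 cx; apply: contraT => nd; case: JM; exists u, y, c, v.
  by split; split=> //; rewrite boxE // -leq_col_length // cy; lia.
have H c : 0 < c < x -> hook_length lam (c, y) = (row_length lam c - y) + (x.-1 - c) + 1.
  move=> /andP[c0 cx]; rewrite hook_lengthE ?cy // boxE // -leq_col_length //.
  by rewrite cy; lia.
have: l * (x.-1 - u).+1 <= hook_length lam (u, y).
  apply: (@dvdn_decreasing l x.-1 (fun c => hook_length lam (c, y)) u).
  - by move=> c hc; rewrite col ?H; lia.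
  - by move=> c hc; rewrite !H; [have := row_length_le hp (leqnSn c)|..]; lia.
  - by lia.
rewrite H; last by lia.
rewrite ru /reading_order /ladder /= => h; apply/orP; left.
have h2 : (l.-1) * (x - u) <= v - y.
  have e : (x.-1 - u).+1 = x - u by lia.
  by move: h; rewrite e -{1}(prednK (ltnW (ltnW hl))) mulSn; lia.
(* Here [2 < l] matters: [p] is below [q], so a tie of ladders would be read in the wrong order, and
   the factor 2 makes the inequality strict. *)
have h3 : 2 * (x - u) <= v - y by apply: leq_trans h2; rewrite leq_mul2r; lia.
have h4 : v - y <= l.-1 * (v - y) by apply: leq_pmull; lia.
have -> : v.-1 = y.-1 + (v - y) by lia.
by rewrite mulnDr; lia.
Qed.

(** * Removing a single box *)

Lemma remove_box lam x y : is_partition lam -> removable lam (x, y) ->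
  exists mu, [/\ is_partition mu, add_box mu (x, y) = lam &
    forall u, 0 < u -> row_length mu u = row_length lam u - (u == x)].
Proof.
move=> hp hr; have [x0 y0 rx cy] := removable_row hp hr.
have [dec pos] := partitionP _ hp.
have xs : x <= size lam.
  by rewrite -cy /col_length count_size.
have below : row_length lam x.+1 < y.
  by rewrite ltnNge -leq_col_length // cy ltnn.
case: x => // x in x0 rx cy xs below hr *; rewrite /row_length /= in rx below.
have row mu : (forall k, nth 0 mu k = nth 0 lam k - (k == x)) ->
    forall u, 0 < u -> row_length mu u = row_length lam u - (u == x.+1).
  by move=> h [|u] // _; rewrite /row_length h eqSS.
have dec' k : nth 0 lam k.+1 - (k.+1 == x) <= nth 0 lam k - (k == x).
  have := dec k; case: (eqVneq k x) => [->|_]; last by lia.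
  by rewrite rx; lia.
(* The index [x] is now zero-based. A removable row of length one is the last row and has to be
   dropped altogether, as a zero part is forbidden. *)
case: (ltnP 1 y) => y1.
  have e k : nth 0 (set_nth 0 lam x y.-1) k = nth 0 lam k - (k == x).
    rewrite nth_set_nth /=; case: eqVneq => [->|_]; last by rewrite subn0.
    by rewrite rx subn1.
  exists (set_nth 0 lam x y.-1); split; last exact: row.
    apply/partitionP; split=> k; rewrite !e // size_set_nth.
    move=> hk; have := pos k; case: (eqVneq k x) => [->|_]; last by lia.
    by rewrite rx; lia.
  rewrite /add_box /=; apply: (@eq_from_nth _ 0).
    by rewrite size_incr_nth size_set_nth; case: ifP; lia.
  move=> k _; rewrite nth_incr_nth e eq_sym; case: eqVneq => [->|_]; last by lia.
  by rewrite rx; lia.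
have sx : size lam = x.+1.
  apply/eqP; rewrite eqn_leq xs andbT leqNgt; apply/negP => /pos.
  by lia.
have e k : nth 0 (take x lam) k = nth 0 lam k - (k == x).
  case: (ltnP k x) => hk; first by rewrite nth_take //; lia.
  rewrite nth_default ?size_take_min; last by lia.
  case: (eqVneq k x) => [->|kx]; first by lia.
  by rewrite nth_default; lia.
exists (take x lam); split; last exact: row.
  apply/partitionP; split=> k; rewrite !e // size_take_min => hk.
  by have := pos k; lia.
rewrite /add_box /=; apply: (@eq_from_nth _ 0).
  by rewrite size_incr_nth size_take_min; case: ifP; lia.
move=> k _; rewrite nth_incr_nth e eq_sym; case: eqVneq => [->|_]; last by lia.
by rewrite rx; lia.
Qed.

Lemma residue_below l x y : 1 < l -> residue l (x.+1, y) != residue l (x, y).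
Proof.
move=> l1; apply/eqP => /residue_eq; rewrite /= -addn1 PoszD opprD addrA.
by rewrite cong_pred.
Qed.

Lemma residue_right l x y : 1 < l -> residue l (x, y.+1) != residue l (x, y).
Proof.
move=> l1; rewrite eq_sym; apply/eqP => /residue_eq.
rewrite /= -addn1 PoszD addrAC -[X in cong _ X _](addrK 1%R).
by rewrite cong_pred.
Qed.

Section RemoveBox.

Variables (lam mu : seq nat) (c : position).
Hypotheses (lam_part : is_partition lam) (hc : removable lam c).
Hypothesis mu_row : forall u, 0 < u -> row_length mu u = row_length lam u - (u == c.1).

Lemma mem_remove_box p : (p \in boxes mu) = (p \in boxes lam) && (p != c).
Proof.
case: c mu_row hc => x y /= h; case/(removable_row lam_part) => x0 y0 rx _.
case: p => u v; rewrite !mem_boxes xpair_eqE.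
case: (posnP u) => //= u0; case: (posnP v) => //= v0; rewrite h //.
by case: (eqVneq u x) => [->|_]; rewrite ?rx /=; lia.
Qed.

Lemma addable_removed : addable mu c.
Proof.
rewrite /addable !mem_remove_box eqxx andbF /=.
case: c hc => x y /(removable_row lam_part) [/= x0 y0 rx cy].
rewrite x0 y0 !xpair_eqE !mem_boxes x0 y0 /=.
have -> : (x.-1 == x) = false by lia.
have -> : (y.-1 == y) = false by lia.
rewrite !andbF !andbT rx leq_pred andbT.
have := row_length_le lam_part (leq_pred x); rewrite rx => ->; lia.
Qed.

(** Only the bead of row [c.1] moves, by one step down. *)
Lemma bead_remove_box z : bead mu z =
  (z != c.2%:Z - c.1%:Z)%R && ((z == c.2%:Z - c.1%:Z - 1)%R || bead lam z).
Proof.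
case: c mu_row hc => x y /= h; case/(removable_row lam_part) => x0 y0 rx cy.
have rb u : 0 < u -> row_bead mu u = (row_bead lam u - (u == x)%:Z)%R.
  move=> u0; rewrite /row_bead h //; case: (eqVneq u x) => [->|_]; rewrite ?rx; lia.
have rbx : row_bead lam x = (y%:Z - x%:Z)%R by rewrite /row_bead rx.
apply/beadP/andP => [[u u0]|[zw]].
  rewrite rb //; case: (eqVneq u x) => [-> <-|ux <-].
    by rewrite rbx eqxx; split=> //; lia.
  rewrite subr0; split; last by apply/orP; right; apply/beadP; exists u.
  by apply: contraNneq ux; rewrite -rbx => /(row_bead_inj lam_part)->.
case/orP => [/eqP ->|/beadP[u u0 e]].
  by exists x; rewrite // rb // eqxx rbx.
exists u => //; rewrite rb // (negPf (_ : u != x)) ?subr0 //.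
by apply: contraNneq zw => ux; rewrite -e ux rbx.
Qed.

Lemma bead_removable : bead lam (c.2%:Z - c.1%:Z)%R && ~~ bead lam (c.2%:Z - c.1%:Z - 1)%R.
Proof.
case: c hc => x y /(removable_row lam_part) [x0 y0 rx cy] /=.
apply/andP; split; first by apply/beadP; exists x; rewrite // /row_bead rx.
by apply/(gapP lam_part); exists y; rewrite // /col_gap cy addrAC.
Qed.

Variable l : nat.
Hypothesis l_gt1 : 1 < l.

(** Apart from [p] itself, only neighbours of [p] are tested; their residues differ from that of
    [c], so their membership is unaffected. The addable version is alike. *)
Lemma removable_remove_box p : p != c -> residue l p = residue l c ->
  removable mu p = removable lam p.
Proof.
move=> pc rp; rewrite /removable !mem_remove_box pc andbT.
have -> : (p.1.+1, p.2) != c.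
  by apply: contra (residue_below p.1 p.2 l_gt1) => /eqP ->; rewrite -rp; case: (p).
have -> : (p.1, p.2.+1) != c.
  by apply: contra (residue_right p.1 p.2 l_gt1) => /eqP ->; rewrite -rp; case: (p).
by rewrite !andbT.
Qed.

Lemma addable_remove_box p : p != c -> residue l p = residue l c ->
  addable mu p = addable lam p.
Proof.
move=> pc rp; rewrite /addable !mem_remove_box pc andbT.
case: p rp {pc} => [[|u] [|v]] //= rp.
have -> : (u, v.+1) != c.
  by apply: contra (residue_below u v.+1 l_gt1) => /eqP ->; rewrite -rp.
have -> : (u.+1, v) != c.
  by apply: contra (residue_right u.+1 v l_gt1) => /eqP ->; rewrite -rp.
by rewrite !andbT.
Qed.

End RemoveBox.

(** Flushing depends symmetrically on the two places of each pair [z - 1], [z] with [z] on runner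
    [i], so sliding a bead within such a pair first does not matter. *)
Lemma flushed_step l i (B B1 B' : int -> bool) w : 1 < l ->
  cong l w i -> B w -> ~~ B (w - 1)%R ->
  (forall z, B1 z = (z != w) && ((z == w - 1)%R || B z)) ->
  flushed l i B1 B' -> flushed l i B B'.
Proof.
move=> l1 wi Bw Bw1 e fl z; have [zf zo] := fl z; split=> [zi|zi zi1].
  have [-> ->] := zf zi; rewrite !e.
  have nc : ~~ cong l (z - 1)%R i.
    by apply/negP => /(cong_succl l1); rewrite subrK zi.
  have -> : (z - 1 != w)%R by apply: contra nc => /eqP ->.
  have -> : (z == w - 1)%R = false.
    apply/eqP => zw; have := cong_succl l1 zi; rewrite zw subrK wi //.
  rewrite (inj_eq (addIr _)); case: eqVneq => [->|_] //=.
  by rewrite Bw (negPf Bw1).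
rewrite zo // e.
have -> : z != w by apply: contra zi => /eqP ->.
by case: eqP => // zw; case/negP: zi1; rewrite zw subrK.
Qed.

(** * Signatures and the operator [f_hat] *)

Lemma cancel_signs_sorted (s1 s2 : seq (bool * position)) :
  all (fun c => c.1) s1 -> all (fun c => ~~ c.1) s2 ->
  cancel_signs (s1 ++ s2) = s1 ++ s2.
Proof.
elim: s1 => [_|[[] p] s1 IH] //=; last by move=> a1 a2; rewrite IH.
elim: s2 => [|[[] p] s2 IH] //= a2; rewrite IH //.
by case: s2 a2 {IH} => [|[[] q] s2].
Qed.

Lemma reading_order_total l : total (reading_order l).
Proof. by move=> p q; rewrite /reading_order; lia. Qed.

Lemma reading_order_trans l : transitive (reading_order l).
Proof. by move=> p q r; rewrite /reading_order; lia. Qed.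

(** Columns must be positive because the predecessor in [ladder] identifies columns 0 and 1. *)
Lemma reading_order_anti l p q : 1 < l -> 0 < p.2 -> 0 < q.2 ->
  reading_order l p q -> reading_order l q p -> p = q.
Proof.
case: p q => [x y] [u v] /= l1 y0 v0; rewrite /reading_order /= => h1 h2.
have e : ladder l (x, y) = ladder l (u, v) by lia.
have xu : x = u by lia.
move: e; rewrite /ladder /= xu => /addnI/eqP; rewrite eqn_pmul2l; last by lia.
by move=> /eqP yv; congr (_, _); lia.
Qed.

Lemma addable_rectangle mu p : is_partition mu -> addable mu p -> p \in rectangle mu.
Proof.
case: p => x y hp /and5P[/= x0 y0 _ up left].
apply/allpairsPdep; exists x, y; rewrite !mem_iota; split=> //.
  rewrite x0 add1n ltnS /=; case/orP: up => [/eqP->//|].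
  rewrite mem_boxes => /and3P[x1 _ yx].
  have : x.-1 <= col_length mu y by rewrite leq_col_length.
  by move/leq_trans/(_ (count_size _ _)); lia.
rewrite y0 add1n ltnS /=; case/orP: left => [/eqP->//|].
rewrite mem_boxes => /and3P[_ y1 yx].
have := row_length_le hp x0; rewrite {2}/row_length /= nth0; lia.
Qed.

(** The signature consists of pluses ending with that of [c], followed by minuses; nothing
    cancels. *)
Lemma f_hat_last_addable l i mu c : 1 < l -> is_partition mu ->
  residue l c = Posz i -> addable mu c ->
  (forall p, residue l p = Posz i -> addable mu p -> reading_order l p c) ->
  (forall p, residue l p = Posz i -> removable mu p -> reading_order l c p) ->
  f_hat l i mu = Some (add_box mu c).
Proof.
move=> l1 hp rc ac add rem; rewrite /f_hat /signature.
set s := sort _ _.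
have so : sorted (reading_order l) s by apply/sort_sorted/reading_order_total.
have us : uniq s.
  rewrite sort_uniq filter_uniq // allpairs_uniq ?iota_uniq //.
  by case=> [? ?] [? ?] _ _ [-> ->].
have ms p : (p \in s) = (p \in rectangle mu) &&
    ((residue l p == Posz i) && (addable mu p || removable mu p)).
  by rewrite mem_sort mem_filter andbC.
have cs : c \in s by rewrite ms addable_rectangle // rc eqxx ac.
have pos p : p \in s -> 0 < p.2.
  rewrite ms => /andP[/allpairsPdep[x [y [_ hy ->]]] _] /=.
  by move: hy; rewrite mem_iota => /andP[].
have anti p : p \in s -> reading_order l p c -> reading_order l c p -> p = c.
  by move=> ps; apply: reading_order_anti => //; exact: pos.
case/splitPr: cs => s1 s2 in so us ms anti *.
have {so} : [/\ all (reading_order l ^~ c) s1 & all (reading_order l c) s2].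
  move: so; rewrite (sorted_pairwise (@reading_order_trans l)) pairwise_cat /=.
  case/and3P=> /allrelP r1 _ /andP[-> _]; split=> //; apply/allP => p ps.
  by apply: r1; rewrite ?mem_head.
case=> /allP lt1 /allP gt2.
have [nc1 nc2] : c \notin s1 /\ c \notin s2.
  move: us; rewrite cat_uniq /= negb_or => /and3P[_ /andP[nc1 _] /andP[nc2 _]].
  by split.
have al1 : all (addable mu) s1.
  apply/allP => p ps; have pss : p \in s1 ++ c :: s2 by rewrite mem_cat ps.
  have := pss; rewrite ms => /and3P[_ /eqP rp /orP[//|/(rem _ rp) cp]].
  by move: nc1; rewrite -(anti _ pss (lt1 _ ps) cp) ps.
have al2 : all (fun p => ~~ addable mu p) s2.
  apply/allP => p ps; have pss : p \in s1 ++ c :: s2 by rewrite mem_cat inE ps !orbT.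
  apply/negP => ap; have := pss; rewrite ms => /and3P[_ /eqP rp _].
  by move: nc2; rewrite -(anti _ pss (add _ rp ap) (gt2 _ ps)) ps.
rewrite -cat_rcons map_cat cancel_signs_sorted; last first.
- by rewrite all_map; apply: sub_all al2.
- by rewrite all_map all_rcons; apply/andP; split=> //; apply: sub_all al1.
rewrite filter_cat.
have -> : [seq c0 <- [seq (addable mu p, p) | p <- s2] | c0.1] = [::].
  rewrite filter_map; apply/nilP; rewrite /nilp size_map size_filter.
  by rewrite -leqn0 leqNgt -has_count; apply/hasPn => p /(allP al2).
rewrite cats0 map_rcons filter_rcons /= ac rev_rcons //.
Qed.

(** * Stripping a residue and the final induction *)

Lemma sumn_incr_nth v k : sumn (incr_nth v k) = (sumn v).+1.
Proof.
elim: v k => [|n v IH] [|k] //=; last by rewrite IH addnS.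
by elim: k.
Qed.

(** The removable box [c] read first is taken away. In the result [c] is the last addable position
    of residue [i] and precedes all remaining removable boxes, so [f_hat] restores it. *)
Lemma strip_residue l (i : nat) lam : 1 < l -> i < l -> is_partition lam ->
  (forall p q, residue l p = Posz i -> residue l q = Posz i ->
     addable lam p -> removable lam q -> reading_order l p q) ->
  exists nu, [/\ is_partition nu, flushed l i (bead lam) (bead nu),
    sumn nu <= sumn lam, ladder_node l nu -> ladder_node l lam &
    forall q, residue l q = Posz i -> removable lam q -> sumn nu < sumn lam].
Proof.
move=> l1 il; have [n] := ubnP (sumn lam); elim: n lam => // n IH lam.
rewrite ltnS => sn hp ord.
pose s := sort (reading_order l)
  [seq p <- boxes lam | (residue l p == Posz i) && removable lam p].
have ms p : (p \in s) = (residue l p == Posz i) && removable lam p.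
  rewrite mem_sort mem_filter; case: (boolP (removable _ _)); rewrite ?andbF //.
  by case/and3P => ->; rewrite !andbT.
have := sort_sorted (@reading_order_total l)
  [seq p <- boxes lam | (residue l p == Posz i) && removable lam p].
rewrite -/s; case: s ms => [|c s] ms.
  move=> _; exists lam; split=> // [|q rq hq]; last first.
    by have := ms q; rewrite rq hq eqxx.
  (* A bead on runner [i] just after a gap would be a removable box of residue [i], and none is
     left. *)
  have key z : cong l z i -> bead lam z -> bead lam (z - 1)%R.
    move=> zi /(beadP)[x x0 bx]; apply: contraT => /(gapP hp)[y y0 gy].
    have rxy : row_length lam x = y /\ col_length lam y = x.
      have := leq_col_length hp x0 y0; move: bx gy; rewrite /row_bead /col_gap; lia.
    case: rxy => rx cy; have := ms (x, y); rewrite removableE // andbT in_nil.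
    rewrite /residue /= -rx -/(row_bead lam x) bx.
    by rewrite -(modz_small (_ : 0 <= i%:Z < l)%R) // eqz_mod_dvd -/(cong l z i) zi.
  move=> z; split=> // zi; split; first by rewrite orb_idr //; exact: key.
  by rewrite andb_idl //; exact: key.
rewrite /= (path_sortedE (@reading_order_trans l)) => /andP[/allP cmin _].
have /andP[/eqP rc hc] : (residue l c == Posz i) && removable lam c.
  by rewrite -ms mem_head.
have [mu [mup addmu mu_row]] : exists mu, [/\ is_partition mu, add_box mu c = lam &
    forall u, 0 < u -> row_length mu u = row_length lam u - (u == c.1)].
  by case: (c) hc => x y; exact: remove_box.
have cmin' p : residue l p = Posz i -> removable lam p -> p != c -> reading_order l c p.
  move=> rp hr pc; have := ms p; rewrite rp hr eqxx inE (negPf pc) /=.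
  exact: cmin.
have sum : sumn lam = (sumn mu).+1 by rewrite -addmu /add_box sumn_incr_nth.
have ac := addable_removed hp hc mu_row.
have nrc : ~~ removable mu c.
  by rewrite /removable (mem_remove_box hp hc mu_row) eqxx andbF.
have remmu q : residue l q = Posz i -> removable mu q -> removable lam q && (q != c).
  move=> rq hq; have qc : q != c by apply: contraNneq nrc => <-.
  by rewrite qc andbT -(removable_remove_box hp hc mu_row l1 qc) // rq.
have addmu' p : residue l p = Posz i -> addable mu p -> reading_order l p c.
  move=> rp hpp; have [->|pc] := eqVneq p c.
    by rewrite /reading_order eqxx leqnn orbT.
  by apply: ord => //; rewrite -(addable_remove_box hp hc mu_row l1 pc) // rp.
have remmu' q : residue l q = Posz i -> removable mu q -> reading_order l c q.
  by move=> rq /(remmu _ rq)/andP[hr qc]; exact: cmin'.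
have fmu : f_hat l i mu = Some lam.
  by rewrite -[in RHS]addmu; exact: f_hat_last_addable.
(* The order hypothesis passes to [mu] by transitivity through [c]. *)
have [||p q rp rq /(addmu' _ rp) pc /(remmu' _ rq)|nu [nup fl le nd _]] := IH mu.
- by rewrite -ltnS -sum ltnS.
- by [].
- exact: reading_order_trans.
exists nu; split=> //.
- have /andP[b g] := bead_removable hp hc.
  apply: (flushed_step l1 _ b g (bead_remove_box hp hc mu_row) fl).
  rewrite /cong -eqz_mod_dvd -/(residue l c) rc modz_small //.
- by rewrite sum; exact: leqW.
- by move/nd => h; exact: ladder_node_f il h fmu.
by move=> _ _ _; rewrite sum ltnS.
Qed.

Theorem theorem4p8 (l : nat) (lam : seq nat)
    (hl : 2 < l) (hlam : is_partition lam) (hJM : JM_partition l lam) :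
  ladder_node l lam.
Proof.
have l1 : 1 < l by apply: ltnW.
have [n] := ubnP (sumn lam); elim: n lam hlam hJM => // n IH lam hp JM.
rewrite ltnS => sn.
have [->|nz] := eqVneq lam [::]; first exact: ladder_node_empty.
have s0 : 0 < size lam by case: lam nz {JM hp sn}.
(* The end of the last row is always removable; stripping its residue makes the size drop
   strictly. *)
pose c : position := (size lam, row_length lam (size lam)).
have y0 : 0 < c.2.
  by have [_ ->] := partitionP _ hp; rewrite ?prednK.
have hc : removable lam c.
  apply: removableE => //; apply/eqP; rewrite eqn_leq count_size /=.
  by rewrite leq_col_length.
have l0 : (0 < l%:Z)%R by rewrite ltz_nat ltnW.
have ge0 : (0 <= residue l c)%R by rewrite modz_ge0 // gt_eqF.
have rc : residue l c = Posz `|residue l c| by rewrite gez0_abs.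
have il : `|residue l c| < l by rewrite -ltz_nat -rc ltz_pmod.
have [p q rp rq ap rem|nu [nup fl _ nd lt]] := strip_residue l1 il hp.
  by apply: (addable_before_removable hl hp JM ap rem); rewrite rp rq.
apply/nd/IH => //.
  by apply/JM_partitionP => //; apply: (JM_flushed l1 fl); apply/JM_partitionP.
exact: leq_trans (lt _ rc hc) sn.
Qed.
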